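(* Let $H$ be a separable, infinite dimensional real Hilbert space and let $C\subseteq H$ be a closed, convex, somewhat bounded set. Then there is a residual set $\mathcal{R}\subseteq\mathcal{N}(C)$ such that, for every $f\in\mathcal{R}$, there are no fixed points of $f$ in the interior of $C$ (taken in $H$).
   Context: For a subset $C$ of a Hilbert space $H$ with norm $\|\cdot\|$, $\mathcal{N}(C)$ denotes the set of all nonexpansive mappings $f\colon C\to C$, i.e. mappings with $\|f(x)-f(y)\|\le\|x-y\|$ for all $x,y\in C$. It is endowed with the topology of pointwise convergence, i.e. the coarsest topology containing all sets $\{g\in\mathcal{N}(C): \|g(x)-f(x)\|<\varepsilon\}$ with $f\in\mathcal{N}(C)$, $x\in C$, $\varepsilon>0$. A nonempty, non-singleton convex set $C$ in an infinite dimensional Hilbert space $H$ is called somewhat bounded if there are $x_0\in C$, a finite dimensional subspace $F\subseteq H$ and $\alpha>0$ such that $\alpha B_F\subseteq C-x_0$ and $F^\perp\cap(C-x_0)$ is bounded. Here $B_F$ is the closed unit ball of $F$ and $F^\perp$ the orthogonal complement of $F$ in $H$. A subset of a topological space is meager if it is a countable union of nowhere dense sets, and residual if its complement is meager. *)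

(* Defs.v *)
From HB Require Import structures.
From mathcomp Require Import all_boot all_order all_algebra.
From mathcomp Require Import all_classical all_reals all_analysis.

Set Implicit Arguments.
Unset Strict Implicit.
Unset Printing Implicit Defensive.

Import Order.TTheory GRing.Theory Num.Theory.
Import numFieldNormedType.Exports.

Local Open Scope classical_set_scope.
Local Open Scope ring_scope.

Section Category.
Variable T : topologicalType.

Definition separable := exists2 S : set T, countable S & dense S.

Definition nowhere_dense (A : set T) := interior (closure A) = set0.

Definition meager (A : set T) :=
  exists2 F : (set T)^nat, (forall n, nowhere_dense (F n)) & A = \bigcup_n F n.

Definition residual (A : set T) := meager (~` A).

End Category.

Arguments separable : clear implicits.

Section FiniteDimension.
Variables (R : realType) (V : lmodType R).

Definition lin_span n (e : 'I_n -> V) : set V :=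
  [set v | exists a : 'I_n -> R, v = \sum_(i < n) a i *: e i].

Definition finite_dim_subspace (F : set V) :=
  exists n (e : 'I_n -> V), F = lin_span e.

Definition infinite_dimensional := ~ finite_dim_subspace [set: V].

End FiniteDimension.

Arguments infinite_dimensional {R} V.

(* The norm of [H] is the one induced by the inner product [dot]. Since the
   types of the library carry a norm but no inner product, a real Hilbert space
   is a complete normed space [H] with a [dot] such that
   [norm_induced_by dot]. *)
Definition norm_induced_by (R : realType) (H : normedModType R)
    (dot : {dot H for @idfun R}) :=
  forall x : H, `|x| = Num.sqrt (dot x x).

Section SomewhatBounded.
Variables (R : realType) (H : normedModType R) (dot : {dot H for @idfun R}).

Definition orthocomplement (F : set H) : set H :=
  [set v | forall u, F u -> dot u v = 0].

Definition unit_ball (F : set H) : set H := [set v | F v /\ `|v| <= 1].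

Definition translate (C : set H) (x0 : H) : set H := [set y - x0 | y in C].

Definition somewhat_bounded (C : set H) :=
  [/\ C !=set0, ~ (exists x, C = [set x]), convex_set C &
      exists x0 (F : set H) (alpha : R),
        [/\ C x0, finite_dim_subspace F, 0 < alpha,
            [set alpha *: v | v in unit_ball F] `<=` translate C x0 &
            bounded_set (orthocomplement F `&` translate C x0)]].

End SomewhatBounded.

Section Nonexpansive.
Variables (R : realType) (H : normedModType R) (C : set H).

(* Here [C] is coerced to the subtype of its elements, with the topology
   induced by [H]. *)
Definition nonexpansive : set {ptws C -> C} :=
  [set f | forall x y : C, `|\val (f x) - \val (f y)| <= `|\val x - \val y|].

(* The coercion from sets to types gives this type the topology induced by
   the product topology of [{ptws C -> C}], i.e. the topology of pointwise
   convergence; see [nbhs_nonexpansive_maps]. *)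
Definition nonexpansive_maps : topologicalType := nonexpansive : Type.

Definition has_fixed_point_in (f : nonexpansive_maps) (A : set H) :=
  exists x : C, \val f x = x /\ A (\val x).

Lemma val_eval_continuous (x : C) :
  continuous (fun g : nonexpansive_maps => \val (\val g x) : H).
Proof.
move=> g; apply: (@continuous_comp nonexpansive_maps C H (fun h => \val h x)).
  apply: (@continuous_comp nonexpansive_maps {ptws C -> C} C
            (fun h => \val h) (fun h => h x)).
    exact: (@initial_continuous _ _ (\val : nonexpansive_maps -> _)).
  exact: (@proj_continuous C (fun=> C) x).
exact: (@initial_continuous _ _ (\val : C -> H)).
Qed.

Lemma nbhs_nonexpansive_maps (f : nonexpansive_maps)
    (U : set nonexpansive_maps) :
  nbhs f U <-> exists (s : seq C) (e : R), 0 < e /\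
    forall g : nonexpansive_maps,
      (forall x, x \in s -> `|\val (\val g x) - \val (\val f x)| < e) -> U g.
Proof.
split; last first.
  case=> s [e [e0 sU]].
  suff : \forall g \near nbhs f, forall x, x \in s ->
      `|\val (\val g x) - \val (\val f x)| < e by apply: filterS => g /sU.
  elim: s {sU} => [|y s IHs]; first by apply: nearW => g x; rewrite in_nil.
  have := @val_eval_continuous y f _ (nbhsx_ballx _ e e0); rewrite nbhs_simpl/=.
  move=> ye; near=> g => x; rewrite inE => /predU1P[->|]; last first.
    by move: x; near: g; exact: IHs.
  rewrite distrC; have : ball (\val (\val f y)) e (\val (\val g y)).
    by near: g; exact: ye.
  by rewrite -ball_normE.
rewrite nbhsE => -[_ [[W oW <-] Wf] WU].
pose B (p : seq C * R) : set {ptws C -> C} :=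
  [set g | forall x, x \in p.1 -> `|\val (g x) - \val (\val f x)| < p.2].
pose G : set_system {ptws C -> C} := filter_from [set p | 0 < p.2] B.
have FG : Filter G.
  apply: filter_from_filter; first by exists ([::], 1); rewrite /= ltr01.
  move=> [s1 e1] [s2 e2] /= e10 e20; exists (s1 ++ s2, Num.min e1 e2).
    by rewrite /= lt_min e10.
  move=> g Bg; split=> x /= xs.
    by have := Bg x; rewrite /= mem_cat xs lt_min => /(_ isT)/andP[].
  by have := Bg x; rewrite /= mem_cat xs orbT lt_min => /(_ isT)/andP[].
have : G --> (\val f : {ptws C -> C}).
  apply/cvg_sup => x A; rewrite nbhsE => -[_ [[_ [V oV <-] <-] Vf] VA].
  have : nbhs (\val (\val f x)) V by apply: open_nbhs_nbhs; split.
  case/nbhs_ballP=> e /= e0 eV; exists ([:: x], e) => //= g Bg.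
  apply/VA/eV; rewrite -ball_normE /= distrC.
  by apply: Bg; rewrite /= mem_seq1.
move/(_ W); case; first by apply: open_nbhs_nbhs; split.
move=> [s e] /= e0 BW; exists s, e; split=> // g Bg.
by apply/WU/BW => x /Bg.
Unshelve. all: by end_near. Qed.

End Nonexpansive.

(* Main.v *)
Require Import Defs.
From HB Require Import structures.
From mathcomp Require Import all_boot all_order all_algebra.
From mathcomp Require Import all_classical all_reals all_analysis.
From mathcomp Require Import lra.
Import Order.TTheory GRing.Theory Num.Theory.
Import numFieldNormedType.Exports.
Local Open Scope classical_set_scope.
Local Open Scope ring_scope.

(** The maps with a fixed point in the interior of [C] are the union over [N] of
    the sets of maps having a fixed point [q] with [|q| <= N] and with the ball
    of radius [1 / (N + 1)] around [q] contained in [C].  Each of these sets is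
    nowhere dense ([deep_fixed_point_nowhere_dense]), for two reasons.

    One value can exclude such fixed points ([fixed_point_trap]).  If [g] is
    nonexpansive, its fixed points are at least as close to [g y] as to [y].
    When [y] is near a point outside [C], [n] is the normal of a hyperplane
    through that point with [C] on its lower side, and [g y = y + sigma n] with
    [sigma > 0], this forces the fixed points to be
    above [y] in the direction [n], hence near the boundary of [C].  The
    exclusion persists when [g y] is slightly perturbed, that is, on a
    neighbourhood of [g] for pointwise convergence.

    And such a [g] exists near any [f], that is, with prescribed approximate
    values at finitely many points ([trapping_perturbation]).  Replace [f] by a
    strict contraction close to it, with a fixed point [p] in the interior of
    [C].  As [H] is infinite dimensional there is a unit vector [e] orthogonal
    to [p], to the prescribed points and to their images; the map can be
    modified to act as the identity in the direction [e] without changing the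
    prescribed values ([freeze_direction]), so that the whole line [p + t e]
    becomes fixed.  Choosing [e] also orthogonal to the subspace [F] of the
    definition of somewhat bounded sets, this line leaves [C]
    ([orthogonal_rays_exit]).  Just before it does, pick [y] on it, and let [g]
    be the modified map translated by a small multiple of such a normal and
    followed by the metric projection onto [C]. *)

Set Implicit Arguments.
Unset Strict Implicit.

(** * Real inner products *)
Section InnerProduct.
Context (R : realType) (H : normedModType R) (dot : {dot H for @idfun R}).
Context (Hdot : norm_induced_by dot).

Lemma dotC x y : dot x y = dot y x.
Proof. by rewrite (@hermC _ _ _ _ dot) expr0 mul1r. Qed.

Lemma dotDr x y z : dot x (y + z) = dot x y + dot x z.
Proof. exact: linearD. Qed.

Lemma dotZr a x y : dot x (a *: y) = a * dot x y.
Proof. by rewrite linearZ. Qed.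

Lemma dotDl x y z : dot (y + z) x = dot y x + dot z x.
Proof. by rewrite !(dotC _ x) dotDr. Qed.

Lemma dotZl a x y : dot (a *: y) x = a * dot y x.
Proof. by rewrite !(dotC _ x) dotZr. Qed.

Lemma dotNr x y : dot x (- y) = - dot x y.
Proof. exact: linearN. Qed.

Lemma dotNl x y : dot (- y) x = - dot y x.
Proof. by rewrite !(dotC _ x) dotNr. Qed.

Lemma dot0r x : dot x 0 = 0.
Proof. exact: linear0. Qed.

Definition dotE := (dotDl, dotDr, dotNl, dotNr, dotZl, dotZr).

Lemma dot_norm x : dot x x = `|x| ^+ 2.
Proof.
rewrite Hdot sqr_sqrtr //; have [->|x0] := eqVneq x 0; first by rewrite dot0r.
exact: ltW (@neq0_dnorm_gt0 _ _ _ dot x x0).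
Qed.

Lemma le_sqnorm x y : (`|x| <= `|y|) = (dot x x <= dot y y).
Proof. by rewrite !dot_norm ler_sqr ?nnegrE. Qed.

(** Cauchy-Schwarz, from [0 <= | |y| x - |x| y |^2]. *)
Lemma dot_le x y : dot x y <= `|x| * `|y|.
Proof.
have := sqr_ge0 `| `|y| *: x - `|x| *: y|.
rewrite -dot_norm !dotE (dotC y x) !dot_norm.
have [->|x0] := eqVneq x 0; first by rewrite dotC dot0r normr0 mul0r.
have [->|y0] := eqVneq y 0; first by rewrite dot0r normr0 mulr0.
have : 0 < `|x| * `|y| by rewrite mulr_gt0 ?normr_gt0.
nra.
Qed.

End InnerProduct.

(** * Convex sets and their interiors *)
Section Convexity.
Context (R : realType) (H : normedModType R).
Implicit Types (C : set H) (x y : H).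

Lemma convex_comb C x y (l : R) : convex_set C -> C x -> C y ->
  0 <= l -> l <= 1 -> C (l *: x + (1 - l) *: y).
Proof.
move=> Cconv Cx Cy l0 l1.
have := Cconv x y (Itv01 l0 l1); rewrite !inE => /(_ Cx Cy).
by rewrite /conv /=.
Qed.

Lemma interiorP C x :
  interior C x <-> exists2 r : R, 0 < r & forall y, `|x - y| < r -> C y.
Proof.
split=> [/nbhs_ballP[r r0 xC]|[r r0 xC]].
  by exists r => // y xy; apply: xC; rewrite -ball_normE.
by apply/nbhs_ballP; exists r => // y; rewrite -ball_normE; exact: xC.
Qed.

Lemma closed_notinP C x : closed C -> ~ C x ->
  exists2 r : R, 0 < r & forall y, `|x - y| < r -> ~ C y.
Proof.
move=> Ccl nCx; apply/(interiorP (~` C)).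
by apply: open_nbhs_nbhs; split => //; exact: closed_openC.
Qed.

(** The homothety of centre [y] and ratio [l] maps a ball around [x] into
    [C]; its image is a ball of radius [l * r]. *)
Lemma convex_comb_interior C x y (l : R) : convex_set C ->
  interior C x -> C y -> 0 < l -> l <= 1 ->
  interior C (l *: x + (1 - l) *: y).
Proof.
move=> Cconv /interiorP[r r0 xC] Cy l0 l1; apply/interiorP.
exists (l * r) => [|z zr]; first exact: mulr_gt0.
have -> : z = l *: (l^-1 *: (z - (1 - l) *: y)) + (1 - l) *: y.
  by rewrite scalerA divff ?gt_eqF// scale1r subrK.
apply: convex_comb => //; last exact: ltW.
apply: xC; rewrite -(ltr_pM2l l0); apply: le_lt_trans zr.
rewrite -{1}(gtr0_norm l0) -normrZ scalerBr scalerA divff ?gt_eqF// scale1r.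
by rewrite opprB addrA.
Qed.

(** The directions of the rays in a closed convex set do not depend on the
    base point: [b + t e] is the limit, as [l] tends to 0, of the points
    [l (a + (t / l) e) + (1 - l) b], which lie in [C]. *)
Lemma recession C (a b e : H) : closed C -> convex_set C -> C a -> C b ->
  (forall t : R, 0 <= t -> C (a + t *: e)) ->
  forall t : R, 0 <= t -> C (b + t *: e).
Proof.
move=> Ccl Cconv Ca Cb ray t t0; apply: contrapT => /(closed_notinP Ccl).
case=> r r0 far.
pose l := r / (r + `|a - b|).
have d0 : 0 < r + `|a - b| by rewrite ltr_pwDl.
have l0 : 0 < l by rewrite divr_gt0.
have l1 : l <= 1 by rewrite ler_pdivrMr// mul1r lerDl.
have ld : l * (r + `|a - b|) = r by rewrite divfK ?gt_eqF.
apply: (far (l *: (a + (t / l) *: e) + (1 - l) *: b)); last first.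
  apply: convex_comb => //; last exact: ltW.
  by apply/ray/divr_ge0 => //; exact: ltW.
have -> : l *: (a + (t / l) *: e) + (1 - l) *: b = b + t *: e + l *: (a - b).
  rewrite scalerDr scalerA mulrCA divff ?gt_eqF// mulr1 scalerBl scale1r.
  by rewrite scalerBr addrC [_ *: a + _]addrC addrACA [- _ + _ *: a]addrC.
rewrite opprD addNKr normrN normrZ gtr0_norm// -ltr_pdivlMl//.
by rewrite -ld mulrA mulVf ?gt_eqF// mul1r ltrDr.
Qed.

End Convexity.

(** * The metric projection onto a closed convex set *)
Section Projection.
Context (R : realType) (H : completeNormedModType R).
Context (dot : {dot H for @idfun R}) (Hdot : norm_induced_by dot).
Context (C : set H).
Context (Cclosed : closed C) (Cconvex : convex_set C) (C0 : C !=set0).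

(** By the parallelogram identity, two points of [C] whose squared distance to
    [x] exceeds the infimum [D] by less than [r] are at squared distance less
    than [4 r] from each other.  The almost-minimizing subsets of [C] therefore
    generate a Cauchy filter, and its limit is the nearest point. *)
Lemma nearest_point x : exists2 c, C c & forall y, C y -> `|x - c| <= `|x - y|.
Proof.
pose D := inf [set `|x - y| ^+ 2 | y in C].
have Dlb y : C y -> D <= `|x - y| ^+ 2.
  move=> Cy; apply: ge_inf; last by exists y.
  by exists 0 => _ [z _ <-]; exact: sqr_ge0.
pose B (r : R) := [set c | C c /\ `|x - c| ^+ 2 < D + r].
have B0 r : 0 < r -> B r !=set0.
  move=> r0; pose E := [set `|x - y| ^+ 2 | y in C].
  have [|_ [c Cc <-] cD] := @inf_adherent _ E r r0.
    split; first by have [y Cy] := C0; exists (`|x - y| ^+ 2), y.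
    by exists 0 => _ [z _ <-]; exact: sqr_ge0.
  by exists c.
pose F := filter_from [set r : R | 0 < r] B.
have FF : ProperFilter F.
  apply: filter_from_proper => //; apply: filter_from_filter.
    by exists 1 => /=.
  move=> r s /= r0 s0; exists (Num.min r s); first by rewrite /= lt_min r0.
  by move=> c [Cc cm]; split; split => //; apply: lt_le_trans cm _;
    rewrite lerD2l ge_min lexx ?orbT.
have close (r : R) c c' : B r c -> B r c' -> `|c - c'| ^+ 2 < 4 * r.
  move=> [Cc cr] [Cc' cr'].
  have h0 : 0 <= 2^-1 :> R by [].
  have h1 : 2^-1 <= 1 :> R by lra.
  have := Dlb _ (convex_comb Cconvex Cc Cc' h0 h1).
  have E : (1 - 2^-1 : R) = 2^-1 by lra.
  rewrite E; move: cr cr'; rewrite -!(dot_norm Hdot) !dotE.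
  rewrite (dotC dot c x) (dotC dot c' x) (dotC dot c' c); lra.
have cF : cauchy F.
  apply/cauchy_exP => e e0.
  pose r := e ^+ 2 / 4; have r0 : 0 < r by rewrite divr_gt0// exprn_gt0.
  have [c Bc] := B0 r r0; exists c; exists r => //= c' Bc'.
  rewrite -ball_normE /=; have := close _ _ _ Bc Bc'.
  by rewrite /r mulrC divfK// ltr_pXn2r// nnegrE// ltW.
have Fl : id @ F --> lim F := @cauchy_cvg _ F FF cF.
have Cl : C (lim F).
  by apply: (closed_cvg C _ _ _ Fl) => //; exists 1 => //= c [].
exists (lim F) => // y Cy.
have -> : (`|x - lim F| <= `|x - y|) = (`|x - lim F| ^+ 2 <= `|x - y| ^+ 2).
  by rewrite ler_sqr ?nnegrE.
apply: le_trans (Dlb _ Cy).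
apply/ler_addgt0Pr => e e0.
have cv : (fun c => `|x - c| ^+ 2) @ F --> `|x - lim F| ^+ 2.
  apply: (@cvg_comp _ _ _ (fun c => `|x - c|) (fun r => r ^+ 2) _
    (nbhs `|x - lim F|)).
    apply: cvg_norm; by apply: cvgB Fl; exact: cvg_cst.
  exact: exprn_continuous.
apply: (closed_cvg (fun r : R => r <= D + e) _ _ _ cv).
  exact: closed_le.
by exists e => //= c [_ /ltW].
Qed.

(** Otherwise a short step from [c] towards [y] would come closer to [x]: the
    squared distance varies by [- 2 t a + t^2 K]. *)
Lemma nearest_point_obtuse x c : C c ->
    (forall y, C y -> `|x - c| <= `|x - y|) ->
  forall y, C y -> dot (x - c) (y - c) <= 0.
Proof.
move=> Cc cmin y Cy; rewrite leNgt; apply/negP; set a := dot _ _ => a0.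
pose K := dot (y - c) (y - c).
have K0 : 0 <= K by rewrite /K (dot_norm Hdot) sqr_ge0.
(* Any t in ]0, 1] with t * K < 2 * a contradicts minimality. *)
pose t := a / (a + K).
have aK0 : 0 < a + K by lra.
have t0 : 0 < t by rewrite divr_gt0.
have t1 : t <= 1 by rewrite ler_pdivrMr// mul1r; lra.
have ta : t * (a + K) = a by rewrite divfK ?gt_eqF.
have := cmin _ (convex_comb Cconvex Cy Cc (ltW t0) t1).
have -> : x - (t *: y + (1 - t) *: c) = (x - c) - t *: (y - c).
  rewrite scalerBl scale1r scalerBr !opprD !opprK -!addrA; congr (_ + _).
  by rewrite [- c + _]addrC [RHS]addrC !addrA.
rewrite (le_sqnorm Hdot); clearbody t; move: K0 aK0 ta a0; rewrite /K /a.
move: (x - c) (y - c) => u v; rewrite !(dotE dot) (dotC dot v u).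
move: (dot u v) (dot u u) (dot v v) => a' b k k0 ak0 ta a0.
have := mulr_gt0 t0 a0; nra.
Qed.

Lemma metric_projection : exists P : H -> H,
  [/\ forall x, C (P x),
      forall x, C x -> P x = x,
      forall x y, `|P x - P y| <= `|x - y| &
      forall x y, C y -> dot (x - P x) (y - P x) <= 0].
Proof.
have nearest x : exists c, C c /\ forall y, C y -> dot (x - c) (y - c) <= 0.
  have [c Cc cmin] := nearest_point x.
  by exists c; split => //; exact: nearest_point_obtuse.
have [P PC] := choice nearest.
have CP x : C (P x) by have [] := PC x.
have obtuse x y : C y -> dot (x - P x) (y - P x) <= 0.
  by have [_] := PC x; exact.
exists P; split => // [x Cx|x y].
  have := obtuse x x Cx; rewrite (dot_norm Hdot) => xP.
  apply/eqP; rewrite eq_sym -subr_eq0 -normr_eq0 -sqrf_eq0.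
  by rewrite eq_le xP sqr_ge0.
have := obtuse x _ (CP y); have := obtuse y _ (CP x).
have : 0 <= dot ((x - y) - (P x - P y)) ((x - y) - (P x - P y)).
  by rewrite (dot_norm Hdot) sqr_ge0.
rewrite (le_sqnorm Hdot); move: (P x) (P y) => u v; rewrite !(dotE dot).
rewrite !(dotC dot y) !(dotC dot u) (dotC dot v x).
lra.
Qed.

End Projection.

(** * Unit vectors orthogonal to finitely many vectors *)
Section FreeDirection.
Context (R : realType) (H : normedModType R).
Context (dot : {dot H for @idfun R}) (Hdot : norm_induced_by dot).

(** The coefficients are indexed by [nat], so that extending the list at its
    head shifts them by a pattern matching, without casts between ordinals. *)
Definition lincomb (s : seq H) (k : nat -> R) := \sum_(i < size s) k i *: s`_i.

Lemma dot_lincomb0 (s : seq H) k c :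
  (forall u, u \in s -> dot u c = 0) -> dot (lincomb s k) c = 0.
Proof.
move=> sc; rewrite dotC linear_sum big1 // => i _ /=.
by rewrite dotZr dotC sc ?mulr0// mem_nth.
Qed.

(** A Gram-Schmidt step without an orthonormal family: to add [u], decompose
    it along [s] as a combination plus a remainder [r], and subtract from the
    remainder of [x] its component along [r]. *)
Lemma orthogonal_decomposition (s : seq H) (x : H) :
  exists k, forall u, u \in s -> dot u (x - lincomb s k) = 0.
Proof.
elim: s x => [|u s IH] x; first by exists (fun=> 0).
have [ku ou] := IH u; have [kx ox] := IH x.
pose r := u - lincomb s ku; pose c := x - lincomb s kx.
(* If u depends on s, then r = 0 and l = 0 since division by 0 gives 0. *)
pose l := dot r c / dot r r.
have rcl : dot r (c - l *: r) = 0.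
  rewrite dotDr dotNr dotZr; have [r0|rN0] := eqVneq (dot r r) 0; last first.
    by rewrite /l divfK// subrr.
  have -> : r = 0.
    by move/eqP: r0; rewrite (dot_norm Hdot) sqrf_eq0 normr_eq0 => /eqP.
  by rewrite !(dotC dot 0) !dot0r mulr0 subr0.
pose k i := if i is j.+1 then kx j - l * ku j else l.
exists k; have -> : x - lincomb (u :: s) k = c - l *: r.
  rewrite /lincomb big_ord_recl /= /c /r /lincomb.
  under eq_bigr do rewrite scalerBl -scalerA.
  rewrite big_split /= sumrN -scaler_sumr.
  rewrite scalerBr !opprD !opprK -!addrA; congr (_ + _).
  by rewrite addrCA.
have os v : v \in s -> dot v (c - l *: r) = 0.
  by move=> vs; rewrite dotDr dotNr dotZr ox// ou// mulr0 subr0.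
move=> v; rewrite inE => /orP[/eqP ->|]; last exact: os.
by rewrite -(subrK (lincomb s ku) u) dotDl rcl add0r dot_lincomb0.
Qed.

(** Normalize the remainder of a vector that [s] does not span. *)
Lemma unit_orthogonal (Hinf : infinite_dimensional H) (s : seq H) :
  exists2 e : H, `|e| = 1 & forall u, u \in s -> dot u e = 0.
Proof.
have [x xs] : exists x, forall k, x <> lincomb s k.
  apply: contrapT => /forallNP all_s; apply: Hinf.
  exists (size s), (fun i => s`_i); apply/seteqP; split=> // x _.
  have /existsNP[k /contrapT ->] := all_s x.
  by exists (fun i => k i).
have [k ok] := orthogonal_decomposition s x.
pose r := x - lincomb s k.
have r0 : `|r| != 0.
  by rewrite normr_eq0 subr_eq0; apply/eqP; exact: xs.
exists (`|r|^-1 *: r); first by rewrite normrZ normfV normr_id mulVf.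
by move=> u us; rewrite dotZr ok// mulr0.
Qed.

End FreeDirection.

(** * Nonexpansive self-maps of the whole space *)

(** Maps of [C] are handled through extensions to all of [H], so that they
    can be composed with the projections of [H] and added to vectors. *)
Definition nonexpanding (R : realType) (H : normedModType R) (F : H -> H) :=
  forall x y, `|F x - F y| <= `|x - y|.

Section Contraction.
Context (R : realType) (H : completeNormedModType R).

Lemma contraction_fixed_point (F : H -> H) (k : R) : 0 <= k -> k < 1 ->
  (forall x y, `|F x - F y| <= k * `|x - y|) -> exists p, F p = p.
Proof.
move=> k0 k1 Fk.
have F_contraction : is_contraction [fun of totalfun F].
  by exists (NngNum k0); split => // -[x y] _; exact: Fk.
have [] := banach_fixed_point F_contraction; first exact: closedT.
  by exists 0.
by move=> p _ pF; exists p.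
Qed.

(** Mixing a little of the interior point [w] into [F] gives a strict
    contraction, which has a fixed point by Banach's theorem.  Every value of
    the mixture is a convex combination with an interior point, hence interior;
    so is the fixed point. *)
Lemma near_contraction (C : set H) (F : H -> H) (s : seq H) (w : H) (eps : R) :
  convex_set C -> interior C w -> nonexpanding F -> (forall x, C (F x)) ->
  0 < eps ->
  exists F' : H -> H, [/\ nonexpanding F', forall x, C (F' x),
    forall x, x \in s -> `|F' x - F x| < eps &
    exists2 p, interior C p & F' p = p].
Proof.
move=> Cconv Cw Fne CF eps0.
have [M M0 sM] : exists2 M, 0 < M & forall x, x \in s -> `|w - F x| <= M.
  elim: s => [|u s [M M0 sM]]; first by exists 1.
  exists (M + `|w - F u|); first by rewrite ltr_pwDl.
  move=> x; rewrite inE => /orP[/eqP ->|/sM xM]; first by rewrite lerDr ltW.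
  by rewrite (le_trans xM)// lerDl.
pose k := eps / (eps + M).
have k0 : 0 < k by rewrite divr_gt0// addr_gt0.
have k1 : k <= 1 by rewrite ler_pdivrMr ?addr_gt0// mul1r lerDl ltW.
have kM : k * M < eps.
  rewrite /k mulrAC ltr_pdivrMr ?addr_gt0// mulrDr ltrDr; exact: mulr_gt0.
pose F' x := k *: w + (1 - k) *: F x.
have F'F' x y : `|F' x - F' y| <= (1 - k) * `|x - y|.
  rewrite /F' opprD addrACA subrr add0r -scalerBr normrZ ger0_norm ?subr_ge0//.
  by apply: ler_wpM2l; rewrite ?subr_ge0.
have [p F'p] : exists p, F' p = p.
  by apply: contraction_fixed_point F'F'; lra.
exists F'; split => [x y|x|x xs|].
- apply: le_trans (F'F' x y) _; rewrite ler_piMl//; lra.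
- by apply: (@interior_subset _ C); exact: convex_comb_interior.
- have -> : F' x - F x = k *: (w - F x).
    by rewrite /F' scalerBl scale1r scalerBr addrA addrAC addrK addrC.
  rewrite normrZ gtr0_norm//; apply: le_lt_trans kM.
  by apply: ler_wpM2l; [exact: ltW|exact: sM].
- exists p => //; rewrite -F'p; exact: convex_comb_interior.
Qed.

End Contraction.

(** * Freezing a direction, and normals *)
Section Direction.
Context (R : realType) (H : completeNormedModType R).
Context (dot : {dot H for @idfun R}) (Hdot : norm_induced_by dot).
Context (C : set H).
Context (Cclosed : closed C) (Cconvex : convex_set C).

(** Let [T] be the orthogonal projection along [e] and [P] the metric
    projection onto [C].  The map [T F P T + <., e> e] acts on the hyperplane
    orthogonal to [e] as a compression of [F], and as the identity along [e];
    by Pythagoras it is still nonexpansive.  The points of [s] and their images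
    do not see the change, and the fixed point [p] has become a whole line of
    fixed points. *)
Lemma freeze_direction (F : H -> H) (p e : H) (s : seq H) :
  nonexpanding F -> (forall x, C (F x)) -> C p -> F p = p ->
  `|e| = 1 -> dot p e = 0 ->
  (forall x, x \in s -> C x /\ dot x e = 0 /\ dot (F x) e = 0) ->
  exists G : H -> H, [/\ nonexpanding G, forall x, x \in s -> G x = F x &
    forall t : R, G (p + t *: e) = p + t *: e].
Proof.
move=> Fne CF Cp Fp e1 pe se.
have C0 : C !=set0 by exists p.
have [P [CP PC Pne _]] := metric_projection Hdot Cclosed Cconvex C0.
pose T x := x - dot x e *: e.
have ee : dot e e = 1 by rewrite (dot_norm Hdot) e1 expr1n.
have T_id x : dot x e = 0 -> T x = x by rewrite /T => ->; rewrite scale0r subr0.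
have TD x t : T (x + t *: e) = T x.
  rewrite /T dotDl dotZl ee mulr1 scalerDl opprD addrACA subrr addr0.
  by [].
have pyth x y a b :
    `|T x - T y + (a - b) *: e| ^+ 2 = `|T x - T y| ^+ 2 + (a - b) ^+ 2.
  have oT z : dot (T z) e = 0 by rewrite /T dotDl dotNl dotZl ee mulr1 subrr.
  move: (oT x) (oT y); rewrite -!(dot_norm Hdot).
  move: (T x) (T y) => u v ou ov.
  by rewrite !(dotE dot) !(dotC dot e) ou ov ee; lra.
have Tne x y : `|T x - T y| ^+ 2 + (dot x e - dot y e) ^+ 2 = `|x - y| ^+ 2.
  rewrite -pyth; congr (`| _ | ^+ 2).
  by rewrite scalerBl addrACA -opprD /T !subrK.
exists (fun x => T (F (P (T x))) + dot x e *: e); split => [x y|x xs|t].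
- rewrite opprD addrACA -scalerBl.
  rewrite -ler_sqr ?nnegrE// pyth -(Tne x y) lerD2r.
  rewrite ler_sqr ?nnegrE//.
  apply: (@le_trans _ _ `|F (P (T x)) - F (P (T y))|).
    by rewrite -ler_sqr ?nnegrE// -(Tne (F _)) lerDl sqr_ge0.
  by apply: le_trans (Fne _ _) _; exact: Pne.
- have [Cx [xe Fe]] := se x xs.
  by rewrite xe scale0r addr0 (T_id x)// PC// T_id.
- by rewrite TD dotDl dotZl ee pe mulr1 add0r (T_id p)// PC// Fp (T_id p).
Qed.

(** The normal is the direction from the nearest point of [C] to [z]. *)
Lemma supporting_normal z : C !=set0 -> ~ C z ->
  exists2 n, `|n| = 1 & forall c, C c -> dot n (c - z) <= 0.
Proof.
move=> C0 nCz.
have [P [CP _ _ obtuse]] := metric_projection Hdot Cclosed Cconvex C0.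
pose r := z - P z.
have r0 : 0 < `|r|.
  by rewrite normr_gt0 subr_eq0; apply/eqP => zP; apply: nCz; rewrite zP.
exists (`|r|^-1 *: r); first by rewrite normrZ normfV normr_id mulVf ?gt_eqF.
move=> c Cc; rewrite dotZl pmulr_rle0 ?invr_gt0//.
have -> : c - z = (c - P z) - r by rewrite /r opprB addrA subrK.
rewrite dotDr dotNr (dot_norm Hdot).
have := obtuse z c Cc; have := sqr_ge0 `|r|; rewrite -/r; lra.
Qed.

End Direction.

(** * Where a line leaves the set, and what a nearby value forbids *)
Section Trap.
Context (R : realType) (H : normedModType R).
Context (dot : {dot H for @idfun R}) (Hdot : norm_induced_by dot).
Context (C : set H).

(** Walk from [p] in steps of length [a] and stop just before the first point
    that is not interior.  Two steps further the walk is outside [C]: otherwise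
    that first point, lying between a point of [C] and the interior point [p],
    would be interior. *)
Lemma exit_point p e (eta : R) : convex_set C -> interior C p -> 0 < eta ->
  `|e| = 1 -> (exists2 t : R, 0 <= t & ~ C (p + t *: e)) ->
  exists t : R, interior C (p + t *: e) /\
    exists2 z, ~ C z & `|z - (p + t *: e)| < eta.
Proof.
move=> Cconv Cp eta0 e1 [t t0 nCt].
pose a := eta / 3.
have a0 : 0 < a by rewrite divr_gt0.
pose x (n : nat) := p + (a *+ n) *: e.
have seg (r r' : R) : 0 <= r -> r < r' -> C (p + r' *: e) ->
    interior C (p + r *: e).
  move=> r0 rr' Cr'; have r'0 : 0 < r' by apply: le_lt_trans rr'.
  pose l : R := 1 - r / r'.
  have l0 : 0 < l by rewrite subr_gt0 ltr_pdivrMr// mul1r.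
  have l1 : l <= 1 by rewrite gerBl divr_ge0// ltW.
  have -> : p + r *: e = l *: p + (1 - l) *: (p + r' *: e).
    rewrite scalerDr addrA -scalerDl [l + _]addrC subrK scale1r scalerA.
    by rewrite /l subKr divfK ?gt_eqF.
  exact: convex_comb_interior.
have [n nCn] : exists n, ~ interior C (x n).
  exists (Num.bound (t / a)) => /interior_subset Cn; apply: nCt.
  apply: (@interior_subset _ C); apply: seg Cn => //.
  rewrite -[a *+ _]mulr_natl -ltr_pdivrMr//.
  by apply: archi_boundP; rewrite divr_ge0// ltW.
pose Q n := `[< ~ interior C (x n) >].
have exQ : exists n, Q n by exists n; apply/asboolP.
have [[|m] /asboolP nCm minm] := ex_minnP exQ.
  by case: nCm; rewrite /x mulr0n scale0r addr0.
exists (a *+ m); split.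
  by apply: contrapT => nC; have := minm m; rewrite ltnn => /(_ (asboolT nC)).
exists (x m.+2); first by move=> Cm; apply/nCm/(seg _ _ _ _ Cm);
  rewrite ?mulrn_wge0 ?ltW// [ltRHS]mulrS ltrDr.
rewrite /x opprD addrACA subrr add0r -scalerBl -mulrnBr ?leqW//.
rewrite (_ : (m.+2 - m)%N = 2%N); last by rewrite -addn2 addKn.
rewrite normrZ e1 mulr1 ger0_norm ?mulrn_wge0 ?ltW// /a; lra.
Qed.

(** A nonexpansive map with value [h] at [y] and fixed point [q] satisfies
    [|h - q| <= |y - q|], so [q] lies in the half-space of the points closer to
    [h] than to [y].  If [h] is almost [y + sigma n], this bounds [<n, q - y>]
    below by about 0, the error being controlled through [|q| <= N].  On the
    other hand [C] lies below the hyperplane through [z] with normal [n], so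
    that if [q + rho n] is in [C] then [<n, q - z> <= - rho].  The two are
    incompatible as soon as [y] is close to [z]. *)
Lemma fixed_point_trap (y z n h q : H) (sigma rho N : R) :
  `|n| = 1 -> 0 < sigma -> 0 < rho -> 0 <= N ->
  (forall c, C c -> dot n (c - z) <= 0) -> `|z - y| < rho / 2 ->
  `|h - (y + sigma *: n)| < sigma * (rho / 2) / (1 + N + `|y|) ->
  `|h - q| <= `|y - q| -> `|q| <= N -> C (q + rho *: n) -> False.
Proof.
move=> n1 sigma0 rho0 N0 nC zy hy hq qN Cq.
have nn : dot n n = 1 by rewrite (dot_norm Hdot) n1 expr1n.
have := nC _ Cq; rewrite [in X in X -> _]addrAC dotDr dotZr nn mulr1.
have : dot n (z - y) < rho / 2.
  by apply: le_lt_trans zy; rewrite -[leRHS]mul1r -n1 dot_le.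
pose d := h - (y + sigma *: n).
have nq : 0 <= sigma * dot n (q - y) + dot d (q - y).
  have hE : h = y + (sigma *: n + d) by rewrite addrA addrC subrK.
  move: hq; rewrite hE (le_sqnorm Hdot).
  have -> : y + (sigma *: n + d) - q = (sigma *: n + d) - (q - y).
    by rewrite opprB [y + _]addrC -addrA.
  rewrite -[y - q]opprB; move: (q - y) => u.
  rewrite -dotZl -dotDl; move: (sigma *: n + d) => w.
  have : 0 <= dot w w by rewrite (dot_norm Hdot) sqr_ge0.
  rewrite !(dotE dot) (dotC dot u w); lra.
have dq : dot d (q - y) < sigma * (rho / 2).
  apply: le_lt_trans (dot_le Hdot _ _) _.
  apply: (@le_lt_trans _ _ (`|d| * (N + `|y|))).
    apply: ler_wpM2l => //; apply: le_trans (ler_normB _ _) _.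
    by rewrite lerD2r.
  move: hy; rewrite -/d ltr_pdivlMr; last by have := normr_ge0 y; lra.
  apply: le_lt_trans; apply: ler_wpM2l => //; lra.
have : - (rho / 2) < dot n (q - y).
  rewrite -(ltr_pM2l sigma0); lra.
have -> : q - z = (q - y) - (z - y) by rewrite opprB addrA subrK.
rewrite dotDr dotNr; lra.
Qed.

End Trap.

(** * The trapping perturbation *)
Section Perturbation.
Context (R : realType) (H : completeNormedModType R).
Context (dot : {dot H for @idfun R}) (Hdot : norm_induced_by dot).
Context (C : set H).
Context (Hinf : infinite_dimensional H).
Context (Cclosed : closed C) (Cconvex : convex_set C).

(** If the ray from [p] in the direction [e] stayed in [C], so would the ray
    from [x0]; its translate to the origin is orthogonal to [F], contradicting
    boundedness of [C - x0] on the orthocomplement of [F]. *)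
Lemma orthogonal_rays_exit : somewhat_bounded dot C ->
  exists us : seq H, forall e p,
    `|e| = 1 -> (forall u, u \in us -> dot u e = 0) -> C p ->
    exists2 t : R, 0 <= t & ~ C (p + t *: e).
Proof.
move=> [_ _ _ [x0 [F [alpha [Cx0 [n [b Fb]] _ _ bnd]]]]].
exists [seq b i | i <- enum 'I_n] => e p e1 eb Cp.
apply: contrapT => stay.
have ray : forall t : R, 0 <= t -> C (p + t *: e).
  by move=> t t0; apply: contrapT => nC; apply: stay; exists t.
have [M M0 bM] : exists2 M : R, 0 < M & forall v, orthocomplement dot F v ->
    translate C x0 v -> `|v| <= M.
  have [M M0 /= bM] := pinfty_ex_gt0 bnd.
  by exists M => // v Fv Cv; exact: bM.
have : `|(M + 1) *: e| <= M.
  apply: bM.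
    move=> u; rewrite Fb => -[a ->].
    rewrite dotZr dotC linear_sum big1 ?mulr0//.
    by move=> i _; rewrite /= dotZr dotC eb ?mulr0// map_f// mem_enum.
  exists (x0 + (M + 1) *: e); last by rewrite addrAC subrr add0r.
  by apply: (recession Cclosed Cconvex Cp Cx0 ray); lra.
by rewrite normrZ e1 gtr0_norm; lra.
Qed.

(** Make [F] a contraction with an interior fixed point [p], freeze a direction
    [e] orthogonal to the data, follow the line of fixed points [p + t e] to a
    point [y] within [rho / 2] of the complement of [C], and translate the map
    by the small vector [sigma n], where [n] is the normal of a hyperplane
    separating [C] from a point outside it near [y].
    Since [y] is interior, retracting onto [C] does not change the value
    [y + sigma n] taken at [y]. *)
Lemma trapping_perturbation (F : H -> H) (s : seq H) (w : H) (eps rho N : R) :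
  somewhat_bounded dot C -> interior C w ->
  nonexpanding F -> (forall x, C (F x)) -> (forall x, x \in s -> C x) ->
  0 < eps -> 0 < rho -> 0 <= N ->
  exists G : H -> H, [/\ nonexpanding G, forall x, C (G x),
    forall x, x \in s -> `|G x - F x| < eps &
    exists y delta, [/\ C y, 0 < delta & forall h q,
      `|h - G y| < delta -> `|h - q| <= `|y - q| -> `|q| <= N ->
      (forall v, `|v| <= rho -> C (q + v)) -> False]].
Proof.
move=> Csb Cw Fne CF sC eps0 rho0 N0.
have eps20 : 0 < eps / 2 by lra.
have [F' [F'ne CF' F'F [p Cp F'p]]] :=
  near_contraction s Cconvex Cw Fne CF eps20.
have [us exits] := orthogonal_rays_exit Csb.
have [e e1 oe] := unit_orthogonal Hdot Hinf (p :: us ++ s ++ map F' s).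
have Cp' := interior_subset Cp.
have pe : dot p e = 0 by apply: oe; rewrite mem_head.
have [G0 [G0ne G0s G0p]] : exists G : H -> H, [/\ nonexpanding G,
    forall x, x \in s -> G x = F' x &
    forall t : R, G (p + t *: e) = p + t *: e].
  apply: (freeze_direction Hdot Cclosed Cconvex F'ne CF' Cp' F'p e1 pe).
  move=> x xs; split; first exact: sC.
  by split; apply: oe; rewrite inE !mem_cat ?(map_f F' xs) ?xs !orbT.
have rho20 : 0 < rho / 2 by lra.
have [t [Cy [z nCz zy]]] : exists t : R, interior C (p + t *: e) /\
    exists2 z, ~ C z & `|z - (p + t *: e)| < rho / 2.
  apply: exit_point => //; apply: exits => // u us_u.
  by apply: oe; rewrite inE !mem_cat us_u orbT.
set y := p + t *: e in Cy zy.
have C0 : C !=set0 by exists p.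
have [n n1 nC] := supporting_normal Hdot Cclosed Cconvex C0 nCz.
have /interiorP[r r0 yr] := Cy.
pose sigma := Num.min (r / 2) (eps / 4).
have sigma0 : 0 < sigma by rewrite lt_min; lra.
have sigmar : sigma <= r / 2 by rewrite ge_min lexx.
have sigmae : sigma <= eps / 4 by rewrite ge_min lexx orbT.
have normsn : `|sigma *: n| = sigma by rewrite normrZ n1 mulr1 gtr0_norm.
have [P [CP PC Pne _]] := metric_projection Hdot Cclosed Cconvex C0.
exists (fun x => P (G0 x + sigma *: n)); split => //.
- move=> x x'; apply: le_trans (Pne _ _) _.
  by rewrite opprD addrACA subrr addr0.
- move=> x xs; apply: le_lt_trans (ler_distD (F' x) _ _) _.
  rewrite (splitr eps) ltr_leD//; last exact/ltW/F'F.
  rewrite -{1}(PC _ (CF' x)); apply: le_lt_trans (Pne _ _) _.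
  rewrite G0s// addrAC subrr add0r normsn; lra.
have Gy : P (G0 y + sigma *: n) = y + sigma *: n.
  rewrite G0p PC//; apply: yr.
  rewrite opprD addrA subrr add0r normrN normsn; lra.
exists y, (sigma * (rho / 2) / (1 + N + `|y|)); split.
- exact: interior_subset Cy.
- by rewrite divr_gt0 ?mulr_gt0//; have := normr_ge0 y; lra.
move=> h q; rewrite Gy => hy hq qN qrho.
apply: (@fixed_point_trap R H dot Hdot C y z n h q sigma rho N) => //.
by apply: qrho; rewrite normrZ n1 mulr1 gtr0_norm.
Qed.

End Perturbation.

(** * Category in the space of nonexpansive maps *)
Section Generic.
Context (R : realType) (H : completeNormedModType R).
Context (dot : {dot H for @idfun R}) (Hdot : norm_induced_by dot).
Context (C : set H).
Context (Hinf : infinite_dimensional H).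
Context (Cclosed : closed C) (Cconvex : convex_set C).

Lemma nonexpansive_map_of (G : H -> H) :
  nonexpanding G -> (forall x, C (G x)) ->
  exists g : nonexpansive_maps C, forall x : C, \val (\val g x) = G (\val x).
Proof.
move=> Gne CG.
pose g (x : C) : C := exist _ (G (\val x)) (mem_set (CG (\val x))).
have gP : (g : {ptws C -> C}) \in @nonexpansive R H C.
  by rewrite inE => x y; exact: Gne.
by exists (exist _ g gP).
Qed.

Lemma nonexpansive_map_extend (f : nonexpansive_maps C) : C !=set0 ->
  exists F : H -> H, [/\ nonexpanding F, forall x, C (F x) &
    forall x : C, F (\val x) = \val (\val f x)].
Proof.
move=> C0.
have [P [CP PC Pne _]] := metric_projection Hdot Cclosed Cconvex C0.
pose Q x : C := exist _ (P x) (mem_set (CP x)).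
exists (fun x => \val (\val f (Q x))); split => [x y|x|x].
- apply: le_trans (Pne x y).
  by have := valP f; rewrite inE => /(_ (Q x) (Q y)).
- by have := valP (\val f (Q x)); rewrite inE.
- congr (\val (\val f _)); apply: val_inj => /=.
  by apply: PC; have := valP x; rewrite inE.
Qed.

(** The margin [1 / (N + 1)] and the norm bound [N] provide the
    uniformity that [fixed_point_trap] requires; every interior fixed point
    satisfies them for some [N]. *)
Definition deep_fixed_point (N : nat) : set (nonexpansive_maps C) :=
  [set f | exists q : C, [/\ \val f q = q, `|\val q| <= N%:R &
     forall v, `|v| <= N.+1%:R^-1 -> C (\val q + v)]].

(** A basic neighbourhood of [f] constrains finitely many values, so it contains
    a trapping perturbation [g] of [f]; and no map whose value at the trapping
    point [y] is close to that of [g] has such a fixed point. *)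
Lemma deep_fixed_point_nowhere_dense N : somewhat_bounded dot C ->
  nowhere_dense (deep_fixed_point N).
Proof.
move=> Csb; rewrite /nowhere_dense -subset0 => f.
rewrite /interior => fA.
have /nbhs_nonexpansive_maps[s [eps [eps0 sA]]] := fA.
have [_ [[q0 [_ _ q0C]] _]] := nbhs_singleton fA _ filterT.
have rho0 : 0 < N.+1%:R^-1 :> R by rewrite invr_gt0.
(* An interior point of C is needed to build the perturbation; it comes from
   a map of the set itself, which is nonempty as its closure contains f. *)
have Cq0 : interior C (\val q0).
  apply/interiorP; exists N.+1%:R^-1 => // x xq.
  by rewrite -(subrK (\val q0) x) addrC; apply: q0C; rewrite distrC ltW.
have C0 : C !=set0 by exists (\val q0); exact: interior_subset Cq0.
have [F [Fne CF Ff]] := nonexpansive_map_extend f C0.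
have sC x : x \in map \val s -> C x.
  by move=> /mapP[x' _ ->]; have := valP x'; rewrite inE.
have [G [Gne CG GF [y [d [Cy d0 Gtrap]]]]] :=
  trapping_perturbation Hdot Hinf Cclosed Cconvex Csb Cq0 Fne CF sC eps0 rho0
    (ler0n R N).
have [g gG] := nonexpansive_map_of Gne CG.
have gA : closure (deep_fixed_point N) g.
  by apply: sA => x xs; rewrite gG -Ff; apply: GF; exact: map_f.
pose y' : C := exist _ y (mem_set Cy).
have gB : nbhs g [set h : nonexpansive_maps C | `|\val (\val h y') - G y| < d].
  apply/nbhs_nonexpansive_maps; exists [:: y'], d; split=> // h.
  by move=> /(_ y' (mem_head _ _)); rewrite gG.
have [h [[q [hq qN qC]] hy]] := gA _ gB.
apply: (Gtrap _ (\val q) hy _ qN qC).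
rewrite -{1}hq.
by have := valP h; rewrite inE => /(_ y' q).
Qed.

End Generic.

Unset Implicit Arguments.
Set Strict Implicit.

Theorem theorem3p6 (R : realType) (H : completeNormedModType R)
    (dot : {dot H for @idfun R}) (Hdot : norm_induced_by dot)
    (Hsep : separable H) (Hinf : infinite_dimensional H)
    (C : set H) (Cclosed : closed C) (Cconvex : convex_set C)
    (Csb : somewhat_bounded dot C) :
  exists Res : set (nonexpansive_maps C),
    residual Res /\
    forall f : nonexpansive_maps C, Res f -> ~ has_fixed_point_in f (interior C).
Proof.
exists (~` \bigcup_N @deep_fixed_point R H C N); split.
  rewrite /residual setCK; exists (@deep_fixed_point R H C) => // N.
  exact: deep_fixed_point_nowhere_dense Csb.
move=> f deepN [q [fq /interiorP[r r0 qC]]]; apply: deepN.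
pose N := (Num.bound `|\val q| + Num.bound r^-1)%N.
exists N => //; exists q; split => //.
  apply: ltW; apply: lt_le_trans (archi_boundP (normr_ge0 _)) _.
  by rewrite ler_nat leq_addr.
move=> v vN; apply: qC; rewrite opprD addrA subrr add0r normrN.
apply: le_lt_trans vN _; rewrite -[ltRHS]invrK ltf_pV2 ?posrE ?invr_gt0//.
have : r^-1 < (Num.bound r^-1)%:R by apply: archi_boundP; rewrite invr_ge0 ltW.
by move/lt_le_trans; apply; rewrite ler_nat leqW// leq_addl.
Qed.
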